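(* Let $D=(V,E)$ be a digraph with $n=|V|$ vertices and $m=|E|$ arcs, and let $\alpha\in[0,1]$. Let $Z=\sum_{v\in V}(d^+(v))^2$ and let $c_2=\sum_{u,v\in V}A(D)_{uv}A(D)_{vu}$ be the number of closed walks of length $2$ in $D$. Let $\rho(D)$ be the spectral radius of $A_\alpha(D)$, let $\lambda_1,\dots,\lambda_n$ be the eigenvalues of $A_\alpha(D)$ (with algebraic multiplicity), indexed so that $\lambda_1=\rho(D)$, let $x_i=\mathrm{Re}(\lambda_i)$, and let $E(D)=\sum_{i=1}^n|x_i|$ be the low energy. Then $$E(D)\le\rho(D)+\sqrt{(n-1)\left(\alpha^2 Z+(1-\alpha)^2\,\frac{m+c_2}{2}-\rho(D)^2\right)}.$$ Equality holds if and only if $|x_2|=|x_3|=\dots=|x_n|$ and $A_\alpha(D)$ is a normal matrix.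
   Context: A digraph $D=(V,E)$ has a finite nonempty vertex set $V$ and an arc set $E\subseteq V\times V$ without self-loops (an arc $(u,v)\in E$ is written $u\to v$; both $u\to v$ and $v\to u$ may be present). $d^+(v)$ is the out-degree of $v$. The adjacency matrix $A(D)$ has $(u,v)$-entry $1$ if $u\to v$ is an arc and $0$ otherwise; $\mathrm{Deg}(D)$ is the diagonal matrix of out-degrees; $A_\alpha(D)=\alpha\,\mathrm{Deg}(D)+(1-\alpha)A(D)$. The spectral radius is the maximum modulus of the eigenvalues; since $A_\alpha(D)$ is entrywise nonnegative, it is itself an eigenvalue (Perron--Frobenius), so the indexing $\lambda_1=\rho(D)$ is possible. *)

(* Defs.v *)
From mathcomp Require Import all_boot all_order all_algebra.
From mathcomp Require Export spectral.
From mathcomp Require Export complex.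
From mathcomp Require Export reals.

Set Implicit Arguments.
Unset Strict Implicit.
Unset Printing Implicit Defensive.

Import Order.TTheory GRing.Theory Num.Theory.
Local Open Scope ring_scope.
Local Open Scope complex_scope.

Record digraph := Digraph {
  vertex : finType;
  arc : rel vertex;
  vertex_nonempty : (0 < #|vertex|)%N;
  arc_irreflexive : irreflexive arc
}.

Definition outdeg (D : digraph) (v : vertex D) : nat := #|[set w | arc v w]|.

Definition num_vertices (D : digraph) : nat := #|vertex D|.

Definition num_arcs (D : digraph) : nat :=
  #|[set p : vertex D * vertex D | arc p.1 p.2]|.

Definition sum_sq_outdeg (D : digraph) : nat :=
  (\sum_(v : vertex D) outdeg v ^ 2)%N.

(* Matrices are indexed by 'I_(num_vertices D), through the enumeration
   enum_val of the vertices; eigenvalues and normality do not depend on it. *)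
Definition adjacency (R : nzRingType) (D : digraph) :
    'M[R]_(num_vertices D) :=
  \matrix_(i, j) (arc (enum_val i) (enum_val j))%:R.

Definition degree_matrix (R : nzRingType) (D : digraph) :
    'M[R]_(num_vertices D) :=
  diag_mx (\row_i (outdeg (enum_val i))%:R).

Definition A_alpha (R : nzRingType) (D : digraph) (alpha : R) :
    'M[R]_(num_vertices D) :=
  alpha *: degree_matrix R D + (1 - alpha) *: adjacency R D.

Definition closed_walks2 (R : nzRingType) (D : digraph) : R :=
  \sum_(i < num_vertices D) \sum_(j < num_vertices D)
    adjacency R D i j * adjacency R D j i.

Section RealMatrix.
Variables (R : realType) (n : nat).
Implicit Type M : 'M[R]_n.

Definition complexify M : 'M[R[i]]_n := map_mx (real_complex R) M.

(* The complex roots of the characteristic polynomial, listed with algebraic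
   multiplicity in an unspecified order. *)
Definition eigenvalues M : seq R[i] :=
  sval (closed_field_poly_normal (char_poly (complexify M))).

(* The default value 0 of the maximum is harmless: moduli are nonnegative. *)
Definition spectral_radius M : R :=
  \big[Num.max/0]_(z <- eigenvalues M) Normc.normc z.

Definition sum_abs_Re_eigenvalues M : R :=
  \sum_(z <- eigenvalues M) `|complex.Re z|.

End RealMatrix.

Definition low_energy (R : realType) (D : digraph) (alpha : R) : R :=
  sum_abs_Re_eigenvalues (A_alpha D alpha).

Definition rho (R : realType) (D : digraph) (alpha : R) : R :=
  spectral_radius (A_alpha D alpha).

(* Main.v *)
(* By Schur, A_alpha is unitarily similar to a triangular T, so its squared
   Frobenius norm is the sum of all |T_ij|^2, and tr(A_alpha^2) is the sum of
   the lambda_i^2. As 2 Re(z)^2 = |z|^2 + Re(z^2), half the sum of these two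
   quantities, which is alpha^2 Z + (1 - alpha)^2 (m + c_2) / 2, exceeds the sum
   of the x_i^2 by half the off-diagonal mass of T; that mass vanishes exactly
   when A_alpha is normal. Cauchy-Schwarz on x_2, ..., x_n concludes.
   The inequality needs rho to be an eigenvalue. For a nonnegative A, let t0 be
   the infimum of the t admitting a positive w with w A < t w: a minimum
   principle bounds every eigenvalue modulus by t0, and t0 is an eigenvalue. *)
Require Import Defs.
From mathcomp Require Import all_boot all_order all_algebra.
From mathcomp Require Import reals complex spectral.
From mathcomp Require Import classical_sets.
From mathcomp Require Import ring lra.

Import Order.TTheory GRing.Theory Num.Theory.
Local Open Scope ring_scope.
Local Open Scope complex_scope.

Lemma mem_eigenvalues (R : realType) (n : nat) (M : 'M[R]_n) (z : R[i]) :
  (z \in eigenvalues M) = eigenvalue (complexify M) z.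
Proof.
rewrite eigenvalue_root_char /eigenvalues; case: closed_field_poly_normal => r /=.
by rewrite (monicP (char_poly_monic _)) scale1r => ->; rewrite root_prod_XsubC.
Qed.

(** * Perron-Frobenius theory for entrywise nonnegative matrices *)

Section PerronFrobenius.
Variables (R : realType) (n : nat) (A : 'M[R]_n).
Hypothesis A_ge0 : forall i j, 0 <= A i j.

(** Collatz-Wielandt condition in strict form; the weight [w] multiplies [A] on the left, as
    [eigenvalue] speaks of row vectors. *)
Definition dominates (t : R) : Prop :=
  exists2 w : 'I_n -> R, (forall i, 0 < w i) &
    forall j, \sum_i w i * A i j < t * w j.

(* Minimum principle, at an index minimizing [x i / w i]. *)
Lemma dominates_monotone (t : R) (x : 'I_n -> R) : dominates t ->
  (forall j, \sum_i x i * A i j <= t * x j) -> forall j, 0 <= x j.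
Proof.
move=> [w w_gt0 w_lt] x_le k; rewrite leNgt; apply/negP => xk_lt0.
have [j _ j_min] :=
  @Order.TotalTheory.arg_minP _ _ _ k xpredT (fun i => x i / w i) isT.
set m := x j / w j in j_min.
have m_lt0 : m < 0.
  by apply: le_lt_trans (j_min k isT) _; rewrite ltr_pdivrMr ?w_gt0 // mul0r.
have xjE : x j = m * w j by rewrite /m divfK // gt_eqF ?w_gt0.
(* Since [m * w i <= x i] with equality at [j], and [m < 0] reverses the strict bound on [w], entry
   [j] of [x A] exceeds [t * x j]. *)
suff : t * x j < t * x j by rewrite ltxx.
apply: lt_le_trans (x_le j); rewrite {1}xjE mulrCA.
have : m * (t * w j) < m * \sum_i w i * A i j by rewrite ltr_nM2l.
move=> /lt_le_trans; apply; rewrite mulr_sumr; apply: ler_sum => i _.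
by rewrite mulrA ler_wpM2r // -ler_pdivlMr ?w_gt0 // j_min.
Qed.

(** If [t <= s], the minimum principle applies to [- y] and makes it nonnegative, against
    [0 < y k]. *)
Lemma dominates_gt_subeigenvalue (t s : R) (y : 'I_n -> R) (k : 'I_n) :
  dominates t -> (forall j, 0 <= y j) -> 0 < y k ->
  (forall j, s * y j <= \sum_i y i * A i j) -> s < t.
Proof.
move=> t_dom y_ge0 yk_gt0 y_le; rewrite ltNge; apply/negP => le_ts.
suff /(_ k) : forall j, 0 <= - y j by rewrite oppr_ge0 leNgt yk_gt0.
apply: (@dominates_monotone t _ t_dom) => j.
under eq_bigr do rewrite mulNr.
rewrite sumrN mulrN lerN2; apply: le_trans (y_le j).
by rewrite ler_wpM2r.
Qed.

(** By the triangle inequality, the moduli of the entries of an eigenvector form a nonnegative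
    subeigenvector for the modulus of [z]. *)
Lemma dominates_gt_eigenvalue (t : R) (z : R[i]) :
  dominates t -> eigenvalue (complexify A) z -> Normc.normc z < t.
Proof.
move=> t_dom /eigenvalueP[v vA v_neq0].
have [k vk_neq0] : exists k, v 0 k != 0.
  apply/existsP; apply: contraNT v_neq0 => /existsPn v0.
  by apply/eqP/rowP => k; rewrite mxE; apply/eqP/negbNE/v0.
apply: (@dominates_gt_subeigenvalue t _ (fun i => Normc.normc (v 0 i)) k) => //.
- by move=> j; case: (v 0 j) => a b; rewrite sqrtr_ge0.
- have := vk_neq0; rewrite -normr_gt0 => /=; rewrite normc_def -[0]/(0%:C) ltcR.
  by case: (v 0 k).
move=> j; rewrite -Normc.normcM -lecR.
have -> : z * v 0 j = \sum_i v 0 i * (A i j)%:C.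
  have /rowP/(_ j) := vA; rewrite !mxE => <-.
  by apply: eq_bigr => i _; rewrite mxE.
rewrite [leLHS](_ : _ = `|\sum_i v 0 i * (A i j)%:C|); last by [].
apply: le_trans (ler_norm_sum _ _ _) _.
rewrite rmorph_sum /=; apply: ler_sum => i _; rewrite normrM rmorphM /=.
by rewrite [`|(A i j)%:C|]ger0_norm ?ler0c.
Qed.

Lemma dominates_exists : exists t, dominates t.
Proof.
exists (1 + \sum_i \sum_j A i j); exists (fun=> 1) => // j.
rewrite mulr1; under eq_bigr do rewrite mul1r.
rewrite ltr_pwDl // ler_sum // => i _; rewrite (bigD1 j) //= lerDl.
by rewrite sumr_ge0.
Qed.

Lemma dominates_gt0 (t : R) : (0 < n)%N -> dominates t -> 0 < t.
Proof.
move=> n_gt0 t_dom.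
apply: (@dominates_gt_subeigenvalue t 0 (fun=> 1) (Ordinal n_gt0)) => // j.
by rewrite mul0r sumr_ge0 // => i _; rewrite mul1r.
Qed.

Local Open Scope classical_set_scope.

(* If [t0 := inf dominates] were not an eigenvalue, the solution [x] of
   [x (t0 - A) = (1, ..., 1)] would be positive, and would witness that some
   [t < t0] dominates. *)
Lemma eigenvalue_inf_dominates :
  (0 < n)%N -> eigenvalue A (inf [set t | dominates t]).
Proof.
move=> n_gt0; set T := [set t | _]; set t0 := inf T.
have T_lb : has_lbound T by exists 0 => t /(dominates_gt0 _ n_gt0)/ltW.
have T_inf : has_inf T by split=> //; exact: dominates_exists.
apply: contraT; rewrite /eigenvalue negbK => K0.
have B_unit : A - t0%:M \in unitmx by rewrite -row_free_unit -kermx_eq0.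
pose x := - const_mx 1 *m invmx (A - t0%:M) : 'rV[R]_n.
have xE j : \sum_i x 0 i * A i j = t0 * x 0 j - 1.
  have : x *m (A - t0%:M) = - const_mx 1 by rewrite mulmxKV.
  rewrite mulmxBr mul_mx_scalar => /rowP/(_ j); rewrite !mxE.
  by move/eqP; rewrite subr_eq addrC => /eqP.
(* [c] strictly bounds the moduli of all entries of [x], so moving [t0] by at most [c^-1] changes
   [t0 * x 0 j] by less than 1, the slack in [xE]. *)
pose c := 1 + \sum_i `|x 0 i|.
have c_gt0 : 0 < c by rewrite ltr_pwDl ?sumr_ge0.
have x_lt_c j : `|x 0 j| < c.
  rewrite ltr_pwDl // (bigD1 j) //= lerDl sumr_ge0 //.
have cV_gt0 : 0 < c^-1 by rewrite invr_gt0.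
have x_small j d : 0 <= d -> d <= c^-1 -> `|d * x 0 j| < 1.
  move=> d_ge0 d_le; rewrite normrM (ger0_norm d_ge0).
  apply: (@le_lt_trans _ _ (c^-1 * `|x 0 j|)); first by rewrite ler_wpM2r.
  by rewrite mulrC ltr_pdivrMr // mul1r.
have [t t_dom t_lt] := inf_adherent cV_gt0 T_inf.
have t_ge : t0 <= t by exact: ge_inf.
have x_ge0 j : 0 <= x 0 j.
  apply: (@dominates_monotone t (x 0) t_dom) => k; rewrite xE.
  have := @x_small k (t - t0); rewrite subr_ge0 t_ge lerBlDl (ltW t_lt).
  by move=> /(_ isT isT); rewrite ltr_norml => /andP[]; lra.
have x_gt0 j : 0 < x 0 j.
  rewrite lt_def x_ge0 andbT; apply/eqP => xj0.
  have := xE j; rewrite xj0 mulr0 sub0r => sumE.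
  suff : 0 <= \sum_i x 0 i * A i j by rewrite sumE; lra.
  by apply: sumr_ge0 => i _; rewrite mulr_ge0.
(* The same slack below [t0], with [x] now known to be positive, contradicts the infimum. *)
have : T (t0 - c^-1).
  exists (x 0) => // j; rewrite xE.
  by have := @x_small j _ (ltW cV_gt0) (lexx _); rewrite ltr_norml => /andP[]; lra.
by move/(ge_inf T_lb); rewrite -/t0; lra.
Qed.

(** Every dominating [t] exceeds all eigenvalue moduli, so the radius is at most the infimum; the
    infimum is a nonnegative eigenvalue, hence at most the radius. *)
Lemma spectral_radius_eigenvalue :
  (0 < n)%N -> (spectral_radius A)%:C \in eigenvalues A.
Proof.
move=> n_gt0; set T := [set t | dominates t].
have t0_ge0 : 0 <= inf T.
  apply: lb_le_inf; first exact: dominates_exists.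
  by move=> t /(dominates_gt0 _ n_gt0)/ltW.
have t0_in : (inf T)%:C \in eigenvalues A.
  rewrite mem_eigenvalues eigenvalue_root_char -map_char_poly.
  rewrite fmorph_root -eigenvalue_root_char.
  exact: eigenvalue_inf_dominates.
suff -> : spectral_radius A = inf T by [].
apply/le_anti/andP; split.
  rewrite /spectral_radius big_seq.
  apply: (big_ind (fun y => y <= inf T)) => // [x y x_le y_le|z].
    by rewrite ge_max x_le.
  rewrite mem_eigenvalues => z_ev; apply: lb_le_inf; first exact: dominates_exists.
  by move=> t t_dom; exact: ltW (dominates_gt_eigenvalue _ _ t_dom z_ev).
apply: bigmax_sup_seq t0_in _ _ => //=.
by rewrite expr0n addr0 sqrtr_sqr ger0_norm.
Qed.
End PerronFrobenius.

(** * Schur form and departure from normality *)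

Section Schur.
Local Open Scope sesquilinear_scope.

Lemma char_poly_conj (F : fieldType) (n : nat) (P A : 'M[F]_n) :
  P \in unitmx -> char_poly (P *m A *m invmx P) = char_poly A.
Proof.
move=> P_unit; rewrite /char_poly /char_poly_mx.
set Pp := map_mx polyC P; set Qp := map_mx polyC (invmx P).
have PQ : Pp *m Qp = 1%:M by rewrite -map_mxM mulmxV // map_mx1.
have -> : 'X%:M - map_mx polyC (P *m A *m invmx P) =
          Pp *m ('X%:M - map_mx polyC A) *m Qp.
  rewrite mulmxBr mulmxBl -!map_mxM; congr (_ - _).
  by rewrite scalar_mxC -mulmxA PQ mulmx1.
by rewrite !det_mulmx mulrAC -det_mulmx PQ det1 mul1r.
Qed.

(** Both sides are traces of a matrix times its adjoint, so cyclicity of the trace removes [P]. *)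
Lemma sum_sqr_norm_unitary_conj (C : numClosedFieldType) (n : nat) (P A : 'M[C]_n) :
  P \is unitarymx ->
  \sum_i \sum_j `|(P *m A *m P^t*) i j| ^+ 2 = \sum_i \sum_j `|A i j| ^+ 2.
Proof.
move=> P_uni.
have frob (B : 'M[C]_n) : \sum_i \sum_j `|B i j| ^+ 2 = \tr (B *m B^t*).
  apply: eq_bigr => i _; rewrite mxE; apply: eq_bigr => j _.
  by rewrite !mxE normCK.
rewrite !frob !trmx_mul !map_mxM /= trmxCK !mulmxA mulmxKtV // mxtrace_mulC !mulmxA.
by rewrite (mulmx1C (unitarymxP P_uni)) ?mul1mx.
Qed.

Lemma sum_mul_swap_unitary_conj (C : numClosedFieldType) (n : nat)
    (P A : 'M[C]_n) (B := P *m A *m P^t*) :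
  P \is unitarymx ->
  \sum_i \sum_j B i j * B j i = \sum_i \sum_j A i j * A j i.
Proof.
move=> P_uni.
have tr2 (B' : 'M[C]_n) : \sum_i \sum_j B' i j * B' j i = \tr (B' *m B').
  by apply: eq_bigr => i _; rewrite mxE.
rewrite !tr2 /B !mulmxA mulmxKtV // mxtrace_mulC !mulmxA.
by rewrite (mulmx1C (unitarymxP P_uni)) ?mul1mx.
Qed.

Variables (R : realType) (n : nat) (M : 'M[R]_n).

Lemma eigenvalues_conj_trig (P : 'M[R[i]]_n) :
  P \is unitarymx -> is_trig_mx (P *m complexify M *m P^t*) ->
  perm_eq (eigenvalues M) [seq (P *m complexify M *m P^t*) i i | i <- enum 'I_n].
Proof.
move=> P_uni T_trig; apply: prod_XsubC_eq.
rewrite big_map big_enum -(char_poly_trig T_trig) -invmx_unitary //.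
rewrite char_poly_conj ?unitarymx_unit // /eigenvalues.
case: closed_field_poly_normal => r /= ->.
by rewrite (monicP (char_poly_monic _)) scale1r.
Qed.

(** Kept as an exact identity: its right side does not involve [P], so the off-diagonal mass is the
    same for every unitary [P] that triangularizes [M]. *)
Lemma sum_sqr_Re_eigenvalues (P : 'M[R[i]]_n) (T := P *m complexify M *m P^t*) :
  P \is unitarymx -> is_trig_mx T ->
  \sum_(z <- eigenvalues M) complex.Re z ^+ 2 +
    (\sum_i \sum_(j | j != i) Normc.normc (T i j) ^+ 2) / 2 =
  (\sum_i \sum_j M i j ^+ 2 + \sum_i \sum_j M i j * M j i) / 2.
Proof.
move=> P_uni T_trig.
rewrite (perm_big _ (eigenvalues_conj_trig P P_uni T_trig)) big_map big_enum /= -/T.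
have normC2 (z : R[i]) : (Normc.normc z ^+ 2)%:C = `|z| ^+ 2 by rewrite rmorphXn.
have frob : \sum_i \sum_j Normc.normc (T i j) ^+ 2 = \sum_i \sum_j M i j ^+ 2.
  have := sum_sqr_norm_unitary_conj _ _ P (complexify M) P_uni; rewrite -/T => TM.
  apply: (@complexI R); rewrite !rmorph_sum /=.
  under eq_bigr do rewrite rmorph_sum /=.
  under eq_bigr do under eq_bigr do rewrite normC2.
  rewrite TM; apply: eq_bigr => i _; rewrite rmorph_sum; apply: eq_bigr => j _.
  by rewrite mxE -normC2 /= expr0n addr0 sqrtr_sqr real_normK ?num_real.
have tr2 : \sum_i complex.Re (T i i ^+ 2) = \sum_i \sum_j M i j * M j i.
  have := sum_mul_swap_unitary_conj _ _ P (complexify M) P_uni; rewrite -/T => TM.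
  have -> : \sum_i \sum_j M i j * M j i =
      complex.Re (\sum_i \sum_j complexify M i j * complexify M j i).
    rewrite raddf_sum; apply: eq_bigr => i _; rewrite raddf_sum.
    by apply: eq_bigr => j _; rewrite !mxE -rmorphM.
  rewrite -TM raddf_sum; apply: eq_bigr => i _; congr complex.Re.
  (* As [T] is triangular, one of [T i j] and [T j i] vanishes off the diagonal. *)
  rewrite (bigD1 i) //= big1 ?addr0 // => j j_neq_i.
  have /is_trig_mxP T0 := T_trig.
  have : (i < j)%N || (j < i)%N by rewrite -neq_ltn eq_sym.
  by case/orP => /T0 ->; rewrite ?mul0r ?mulr0.
rewrite -frob -tr2 -big_split /= mulr_suml mulr_suml -big_split /=.
apply: eq_bigr => i _; rewrite [X in _ = (X + _) / 2](bigD1 i) //=.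
case: (T i i) => a b; rewrite /= sqr_sqrtr ?addr_ge0 ?sqr_ge0 //; by field.
Qed.

(** The gap is half the off-diagonal mass of a Schur form; if it vanishes, the form is diagonal, so
    the matrix is unitarily diagonalizable, that is, normal. *)
Lemma sum_sqr_Re_eigenvalues_leif : (0 < n)%N ->
  \sum_(z <- eigenvalues M) complex.Re z ^+ 2 <=
    (\sum_i \sum_j M i j ^+ 2 + \sum_i \sum_j M i j * M j i) / 2
    ?= iff (complexify M \is normalmx).
Proof.
move=> n_gt0; have [P P_uni] := Schur (complexify M) n_gt0.
rewrite /similar_to conjymx //= => T_trig.
rewrite -(sum_sqr_Re_eigenvalues _ P_uni T_trig).
set T := P *m _ *m _ in T_trig *; set off := \sum_i \sum_(_ | _) _.
have off_ge0 : 0 <= off.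
  by apply: sumr_ge0 => i _; apply: sumr_ge0 => j _; rewrite sqr_ge0.
split; first by rewrite lerDl divr_ge0.
rewrite -subr_eq0 opprD addrA subrr sub0r oppr_eq0 mulf_eq0 invr_eq0 pnatr_eq0 orbF.
apply/idP/idP => [|M_normal].
  rewrite psumr_eq0; last by move=> i _; apply: sumr_ge0 => j _; rewrite sqr_ge0.
  move=> /allP T0; apply/orthomx_spectral_subproof.
  exists (P, \row_i T i i) => //=.
  suff -> : diag_mx (\row_i T i i) = T.
    rewrite invmx_unitary // /T !mulmxA.
    by rewrite (mulmx1C (unitarymxP P_uni)) mul1mx mulmxKtV.
  apply/matrixP => i j; rewrite [LHS]mxE mxE; case: eqVneq => [->//|i_neq_j].
  rewrite mulr0n.
  have := T0 i (mem_index_enum i).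
  rewrite /= psumr_eq0 => [|k _]; last by rewrite sqr_ge0.
  move=> /allP/(_ j (mem_index_enum j)); rewrite /= eq_sym i_neq_j /=.
  by rewrite expf_eq0 => /eqP/Normc.eq0_normc ->.
(* The same identity in a diagonalizing basis: its defect term is the one for [P]. *)
have /orthomx_spectral_subproof[[Q d] /= Q_uni ME] := M_normal.
have QMQ : Q *m complexify M *m Q^t* = diag_mx d.
  rewrite ME -invmx_unitary // !mulmxA.
  by rewrite mulmxV ?unitarymx_unit // mul1mx mulmxK ?unitarymx_unit.
have Q_trig : is_trig_mx (Q *m complexify M *m Q^t*).
  by rewrite QMQ; apply: diag_mx_is_trig; exact: diag_mx_is_diag.
have := sum_sqr_Re_eigenvalues _ Q_uni Q_trig.
rewrite -(sum_sqr_Re_eigenvalues _ P_uni T_trig) QMQ => /addrI.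
rewrite [X in X / 2]big1 => [|i _]; last first.
  rewrite big1 // => j j_neq_i; rewrite mxE eq_sym (negPf j_neq_i) mulr0n.
  by rewrite Normc.normc0 expr0n.
rewrite mul0r => /esym/eqP; rewrite mulf_eq0 invr_eq0 pnatr_eq0 orbF //.
Qed.

End Schur.

(** * Cauchy-Schwarz and the energy bound for real matrices *)

(** Lagrange's identity: the squared differences over all ordered pairs add up to twice the gap, so
    equality forces each of them to vanish. *)
Lemma sqr_sum_leif (R : realFieldType) (I : finType) (A : {pred I}) (a : I -> R) :
  (\sum_(i in A) a i) ^+ 2 <= #|A|%:R * \sum_(i in A) a i ^+ 2
    ?= iff [forall i in A, forall j in A, a i == a j].
Proof.
set F := \sum_(i in A) a i; set Q := \sum_(i in A) a i ^+ 2.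
have dev_sum : \sum_(i in A) \sum_(j in A) (a i - a j) ^+ 2 =
    2 * (#|A|%:R * Q - F ^+ 2).
  have dev_row i : \sum_(j in A) (a i - a j) ^+ 2 =
      #|A|%:R * a i ^+ 2 - 2 * F * a i + Q.
    under eq_bigr do rewrite sqrrB -mulr_natl.
    by rewrite big_split sumrB /= sumr_const -mulr_sumr -mulr_sumr -/F -/Q; ring.
  under eq_bigr do rewrite dev_row.
  by rewrite big_split sumrB /= sumr_const -!mulr_sumr -/F -/Q; ring.
have dev_ge0 i : 0 <= \sum_(j in A) (a i - a j) ^+ 2.
  by apply: sumr_ge0 => j _; exact: sqr_ge0.
have dev_sum_ge0 : 0 <= 2 * (#|A|%:R * Q - F ^+ 2) by rewrite -dev_sum sumr_ge0.
split; first by rewrite -subr_ge0; lra.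
have -> : (F ^+ 2 == #|A|%:R * Q) = (2 * (#|A|%:R * Q - F ^+ 2) == 0).
  by rewrite mulf_eq0 pnatr_eq0 subr_eq0 eq_sym.
rewrite -dev_sum psumr_eq0 //; apply/allP/forall_inP => [dev0 i iA|a_eq i _].
  apply/forall_inP => j jA.
  have := dev0 i (mem_index_enum i).
  rewrite iA /= psumr_eq0 => [|k _]; last exact: sqr_ge0.
  by move=> /allP/(_ j (mem_index_enum j)); rewrite /= jA /= expf_eq0 subr_eq0.
apply/implyP => iA; rewrite big1 // => j jA.
by have /forall_inP/(_ j jA)/eqP-> := a_eq i iA; rewrite subrr expr0n.
Qed.

(** Settles the equality case in order 1, where the factor [n%:R - 1] is zero and the energy bound
    is always attained. *)
Lemma normalmx_dim1 (C : numClosedFieldType) (n : nat) (M : 'M[C]_n) :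
  (n <= 1)%N -> M \is normalmx.
Proof.
case: n M => [|[|//]] M _; apply/normalmxP; first by rewrite !flatmx0.
by apply/matrixP => i j; rewrite !ord1 !mxE !big_ord1 !mxE mulrC.
Qed.

(** Cauchy-Schwarz on the eigenvalues other than [lam i1] is chained with the bound on the sum of
    squares; the chaining conjoins the two equality conditions. *)
Lemma sum_abs_Re_eigenvalues_leif (R : realType) (n : nat) (M : 'M[R]_n)
    (lam : 'I_n -> R[i]) (i1 : 'I_n) (r : R) :
  perm_eq [seq lam i | i <- enum 'I_n] (eigenvalues M) ->
  lam i1 = r%:C -> 0 <= r ->
  sum_abs_Re_eigenvalues M <=
    r + Num.sqrt ((n%:R - 1) *
      ((\sum_i \sum_j M i j ^+ 2 + \sum_i \sum_j M i j * M j i) / 2 - r ^+ 2))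
    ?= iff [forall i in predC1 i1, forall j in predC1 i1,
             `|complex.Re (lam i)| == `|complex.Re (lam j)|]
           && (complexify M \is normalmx).
Proof.
move=> lamE lam_i1 r_ge0.
have n_gt0 : (0 < n)%N by apply: leq_ltn_trans (ltn_ord i1).
have sumE (f : R[i] -> R) : \sum_(z <- eigenvalues M) f z = \sum_i f (lam i).
  by rewrite -(perm_big _ lamE) big_map big_enum.
have := sum_sqr_Re_eigenvalues_leif _ _ M n_gt0.
set S := _ / 2; rewrite /sum_abs_Re_eigenvalues !sumE /=.
rewrite (bigD1 i1) //= [X in _ -> X <= _ ?= iff _](bigD1 i1) //=.
rewrite lam_i1 /= (ger0_norm r_ge0).
set a := fun i => `|complex.Re (lam i)|.
under eq_bigr do rewrite -[X in X ^+ 2]/(complex.Re _) -real_normK ?num_real //.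
move=> sqr_le.
have card_k : #|predC1 i1|%:R = n%:R - 1 :> R.
  by rewrite cardC1 card_ord -subn1 natrB.
have := sqr_sum_leif _ _ (predC1 i1) a; rewrite card_k /=.
have k_ge0 : 0 <= n%:R - 1 :> R by rewrite -card_k ler0n.
set F := \sum_(i | i != i1) a i; set Q := \sum_(i | i != i1) a i ^+ 2.
set all_eq := [forall (i | _), _] => CS.
have F_ge0 : 0 <= F by apply: sumr_ge0 => i _; exact: normr_ge0.
have Q_le : Q <= S - r ^+ 2 ?= iff (complexify M \is normalmx).
  by rewrite leifBRL addrC.
have kQ_le : (n%:R - 1) * Q <= (n%:R - 1) * (S - r ^+ 2)
    ?= iff (complexify M \is normalmx).
  have [k0|k_neq0] := eqVneq (n%:R - 1 : R) 0; last first.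
    by rewrite (mono_leif (ler_pM2l _)) // lt_def k_neq0.
  rewrite k0 !mul0r normalmx_dim1; first exact/leif_refl.
  by move/eqP: k0; rewrite subr_eq0 pnatr_eq1 => /eqP->.
have F_le := leif_trans CS kQ_le.
set G := (n%:R - 1) * _ in F_le *.
(* [Num.sqrt] is zero on negative reals, so comparing the roots needs a nonnegative radicand; this
   one dominates a square. *)
have G_ge0 : 0 <= G := le_trans (sqr_ge0 F) F_le.1.
have FE : F = Num.sqrt (F ^+ 2) by rewrite sqrtr_sqr ger0_norm.
split; first by rewrite lerD2l FE ler_sqrt // F_le.1.
by rewrite (inj_eq (addrI r)) -F_le.2 {1}FE eqr_sqrt // sqr_ge0.
Qed.

(** * Degrees, arcs and closed walks in the entries of [A_alpha] *)

Lemma A_alpha_ge0 (R : realType) (D : digraph) (alpha : R) i j :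
  0 <= alpha <= 1 -> 0 <= A_alpha D alpha i j.
Proof.
move=> /andP[a_ge0 a_le1]; rewrite !mxE addr_ge0 // mulr_ge0 ?subr_ge0 //.
exact: mulrn_wge0.
Qed.

(** Without loops the adjacency diagonal is zero, so no cross terms arise when both positions are
    diagonal or neither is. This covers squares and products of transposed entries alike. *)
Lemma A_alpha_mul (R : comNzRingType) (D : digraph) (alpha : R) i j i' j' :
  (i == j) = (i' == j') ->
  A_alpha D alpha i j * A_alpha D alpha i' j' =
    (alpha ^+ 2 * (outdeg (enum_val i))%:R * (outdeg (enum_val i'))%:R)
      *+ (i == j) +
    (1 - alpha) ^+ 2 * (adjacency R D i j * adjacency R D i' j').
Proof.
move=> eq_ij; rewrite !mxE -eq_ij; case: eqVneq eq_ij => [<-|_ _]; last first.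
  by rewrite !mulr0n !mulr0 !add0r mulrACA expr2.
move=> /esym/eqP <-; rewrite !arc_irreflexive !mulr1n !mulr0 !addr0.
by rewrite mulrACA -expr2 mulrA.
Qed.

Lemma sum_A_alpha_diag (R : nzRingType) (D : digraph) (c : R) :
  \sum_(i < num_vertices D) \sum_(j < num_vertices D)
    (c * (outdeg (enum_val i))%:R * (outdeg (enum_val i))%:R) *+ (i == j) =
  c * (sum_sq_outdeg D)%:R.
Proof.
under eq_bigr => i _ do under eq_bigr => j _ do rewrite mulrb.
under eq_bigr do
  rewrite -big_mkcond /= (eq_bigl _ _ (fun j => eq_sym _ j)) big_pred1_eq
    -mulrA -natrM.
rewrite -mulr_sumr -natr_sum /sum_sq_outdeg; congr (_ * _%:R).
by rewrite (big_enum_val (fun v => outdeg v * outdeg v)%N).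
Qed.

Lemma sum_sqr_adjacency (R : nzRingType) (D : digraph) :
  \sum_i \sum_j adjacency R D i j * adjacency R D i j = (num_arcs D)%:R.
Proof.
rewrite /num_arcs -sum1_card natr_sum [RHS]big_mkcond.
rewrite [RHS](eq_bigr (fun p : vertex D * vertex D => (Defs.arc p.1 p.2)%:R))
  => [|p _]; last first.
  by rewrite inE; case: Defs.arc.
rewrite -(pair_big xpredT xpredT (fun u v => (Defs.arc u v)%:R)) /= [RHS]big_enum_val.
apply: eq_bigr => i _; rewrite [RHS]big_enum_val; apply: eq_bigr => j _.
by rewrite !mxE -natrM mulnb andbb.
Qed.

(** The diagonal contributes the same amount to both sums, so halving leaves the degree term whole
    and averages only the arc and walk counts. *)
Lemma half_sum_A_alpha (R : realType) (D : digraph) (alpha : R) :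
  let A := A_alpha D alpha in
  (\sum_i \sum_j A i j ^+ 2 + \sum_i \sum_j A i j * A j i) / 2 =
  alpha ^+ 2 * (sum_sq_outdeg D)%:R
  + (1 - alpha) ^+ 2 * (((num_arcs D)%:R + closed_walks2 R D) / 2).
Proof.
move=> A.
have -> : \sum_i \sum_j A i j ^+ 2 = alpha ^+ 2 * (sum_sq_outdeg D)%:R +
    (1 - alpha) ^+ 2 * (num_arcs D)%:R.
  rewrite -sum_A_alpha_diag -sum_sqr_adjacency mulr_sumr -big_split /=.
  apply: eq_bigr => i _; rewrite mulr_sumr -big_split /=; apply: eq_bigr => j _.
  by rewrite expr2 A_alpha_mul.
have -> : \sum_i \sum_j A i j * A j i = alpha ^+ 2 * (sum_sq_outdeg D)%:R +
    (1 - alpha) ^+ 2 * closed_walks2 R D.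
  rewrite -sum_A_alpha_diag mulr_sumr -big_split /=.
  apply: eq_bigr => i _; rewrite mulr_sumr -big_split /=; apply: eq_bigr => j _.
  by rewrite A_alpha_mul 1?eq_sym //; case: eqVneq => // ->.
by field.
Qed.

Theorem theorem4p1 (R : realType) (D : digraph) (alpha : R)
    (halpha : 0 <= alpha <= 1) :
  low_energy D alpha <=
    rho D alpha +
    Num.sqrt (((num_vertices D)%:R - 1) *
      (alpha ^+ 2 * (sum_sq_outdeg D)%:R
       + (1 - alpha) ^+ 2 * (((num_arcs D)%:R + closed_walks2 R D) / 2)
       - rho D alpha ^+ 2))
  /\
  forall (lam : 'I_(num_vertices D) -> R[i]) (i1 : 'I_(num_vertices D)),
    perm_eq [seq lam i | i <- enum 'I_(num_vertices D)]
            (eigenvalues (A_alpha D alpha)) ->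
    lam i1 = (rho D alpha)%:C ->
    (low_energy D alpha =
       rho D alpha +
       Num.sqrt (((num_vertices D)%:R - 1) *
         (alpha ^+ 2 * (sum_sq_outdeg D)%:R
          + (1 - alpha) ^+ 2 * (((num_arcs D)%:R + closed_walks2 R D) / 2)
          - rho D alpha ^+ 2))
     <->
     (forall i j : 'I_(num_vertices D), i != i1 -> j != i1 ->
        `|complex.Re (lam i)| = `|complex.Re (lam j)|)
     /\ complexify (A_alpha D alpha) \is normalmx).
Proof.
have n_gt0 : (0 < num_vertices D)%N := vertex_nonempty D.
have A_ge0 i j : 0 <= A_alpha D alpha i j by exact: A_alpha_ge0.
have rho_ge0 : 0 <= rho D alpha by exact: bigmax_ge_id.
rewrite -half_sum_A_alpha; split; last first.
  move=> lam i1 lamE lam_i1.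
  have [_ eq_iff] := sum_abs_Re_eigenvalues_leif _ _ _ _ _ _ lamE lam_i1 rho_ge0.
  split=> [/eqP|[lam_eq A_normal]]; last first.
    apply/eqP; rewrite [_ == _]eq_iff A_normal andbT.
    by apply/forall_inP => i i_neq; apply/forall_inP => j j_neq; exact/eqP/lam_eq.
  rewrite [_ == _]eq_iff => /andP[/forall_inP lam_eq A_normal].
  split=> // i j i_neq j_neq.
  by have /forall_inP/(_ j j_neq)/eqP := lam_eq i i_neq.
(* The inequality mentions no enumeration, so one is supplied: the list [e] itself, with the first
   position of the spectral radius, which Perron-Frobenius places in [e], as [i1]. *)
set e := eigenvalues (A_alpha D alpha).
have size_e : size e = num_vertices D.
  have := size_char_poly (complexify (A_alpha D alpha)).
  rewrite /e /eigenvalues; case: closed_field_poly_normal => r /= ->.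
  by rewrite (monicP (char_poly_monic _)) scale1r size_prod_XsubC => -[].
have rho_e : (rho D alpha)%:C \in e by exact: spectral_radius_eigenvalue.
have idx_lt : (index (rho D alpha)%:C e < num_vertices D)%N.
  by rewrite -size_e index_mem.
have lamE : perm_eq [seq e`_(nat_of_ord i) | i <- enum 'I_(num_vertices D)] e.
  rewrite (map_comp (nth 0 e) (@nat_of_ord _)).
  by rewrite val_enum_ord -size_e -/(mkseq _ _) mkseq_nth.
have lam_i1 : e`_(Ordinal idx_lt) = (rho D alpha)%:C by rewrite nth_index.
by have [] := sum_abs_Re_eigenvalues_leif _ _ _ (fun i => e`_(nat_of_ord i))
  _ _ lamE lam_i1 rho_ge0.
Qed.
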